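(* Suppose the digraph $\mathcal{G}$ is strongly connected, and let the weights $a_{ij},b_{ih}$ be as in the context. Let $M_0=\begin{bmatrix} I-L & 0\\ L & S\end{bmatrix}$. Let $r$ be the largest modulus among the eigenvalues of $M_0$ that remain after two copies of the eigenvalue $1$ are removed from its spectrum (eigenvalues counted with algebraic multiplicity). Set $$\bar\epsilon^{(d)}=\frac{(1-r)^n}{(20+8n)^n}.$$ Then for every $\epsilon\in(0,\bar\epsilon^{(d)})$, the deterministic algorithm with parameter $\epsilon$ achieves average consensus.
   Context: Setting: $\mathcal{G}=(\mathcal{V},\mathcal{E})$ is a digraph with $\mathcal{V}=\{1,\dots,n\}$, $n>1$, and no selfloops. An edge $(j,i)$ means that $j$ sends to $i$. Write $\mathcal{N}_i^+=\{j:(j,i)\in\mathcal{E}\}$ and $\mathcal{N}_i^-=\{h:(i,h)\in\mathcal{E}\}$. Weights: $a_{ij}\in(0,1)$ if $j\in\mathcal{N}_i^+$, $a_{ij}=0$ otherwise, and $\sum_j a_{ij}<1$. Also $b_{ih}\in(0,1)$ if $h\in\mathcal{N}_i^-$, $b_{ih}=0$ otherwise, and $\sum_h b_{ih}<1$. Matrices: $L=D-A$, where $A=[a_{ij}]$ and $D=\mathrm{diag}(\sum_j a_{ij})$. $S=(I-\tilde D)+B$, where $B=[b_{ih}]^T$ and $\tilde D=\mathrm{diag}(\sum_h b_{ih})$. For $\epsilon>0$, $M=\begin{bmatrix} I-L & \epsilon I\\ L & S-\epsilon I\end{bmatrix}$. Deterministic algorithm: $(x(k+1),s(k+1))^T=M(x(k),s(k))^T$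 with $x(k),s(k)\in\mathbb{R}^n$ and $s(0)=0$. Average consensus: the algorithm achieves it if for every $x(0)$ we have $(x(k),s(k))\to(x_a\mathbf{1},0)$, where $x_a=\mathbf{1}^Tx(0)/n$. *)

(* Defs.v *)
From HB Require Import structures.
From mathcomp Require Import all_boot all_order all_algebra.
From mathcomp Require Import all_classical all_reals all_analysis.
From mathcomp Require Import complex.
Set Implicit Arguments. Unset Strict Implicit. Unset Printing Implicit Defensive.
Import Order.TTheory GRing.Theory Num.Theory.
Import numFieldNormedType.Exports.
Local Open Scope classical_set_scope.
Local Open Scope ring_scope.

Section Defs.
Variable R : realType.
Variable n : nat.

(* Digraph on vertices 'I_n : [e j i] means the edge (j,i), i.e. j sends to i. *)
Definition no_selfloops (e : rel 'I_n) := forall i, ~~ e i i.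

Definition strongly_connected (e : rel 'I_n) := forall i j, connect e i j.

Definition weights_a (e : rel 'I_n) (a : 'M[R]_n) :=
  (forall i j, (e j i -> 0 < a i j < 1) /\ (~~ e j i -> a i j = 0)) /\
  (forall i, \sum_j a i j < 1).

Definition weights_b (e : rel 'I_n) (b : 'M[R]_n) :=
  (forall i h, (e i h -> 0 < b i h < 1) /\ (~~ e i h -> b i h = 0)) /\
  (forall i, \sum_h b i h < 1).

Definition Lap (a : 'M[R]_n) : 'M[R]_n :=
  diag_mx (\row_i \sum_j a i j) - a.

Definition Smat (b : 'M[R]_n) : 'M[R]_n :=
  (1%:M - diag_mx (\row_i \sum_h b i h)) + b^T.

Definition Mmat (a b : 'M[R]_n) (eps : R) : 'M[R]_(n + n) :=
  block_mx (1%:M - Lap a) (eps%:M) (Lap a) (Smat b - eps%:M).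

Definition M0mat (a b : 'M[R]_n) : 'M[R]_(n + n) :=
  block_mx (1%:M - Lap a) 0 (Lap a) (Smat b).

(* the state (x(k), s(k)) of the deterministic algorithm *)
Definition state (M : 'M[R]_(n + n)) (z0 : 'cV[R]_(n + n)) (k : nat)
  : 'cV[R]_(n + n) := iter k (fun z => M *m z) z0.

Definition average_consensus (M : 'M[R]_(n + n)) :=
  forall x0 : 'cV[R]_n,
    let xa := (\sum_i x0 i 0) / n%:R in
    forall i : 'I_(n + n),
      (fun k => state M (col_mx x0 0) k i 0) @ \oo -->
        (col_mx (const_mx xa) (0 : 'cV[R]_n) : 'cV[R]_(n + n)) i 0.

Definition reduced_char_poly (M : 'M[R]_(n + n)) : {poly R} :=
  char_poly M %/ ('X - 1) ^+ 2.

Definition max_root_modulus (q : {poly R}) (r : R) :=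
  let qC := map_poly (fun x : R => (x%:C)%C) q in
  (exists2 z : R[i], root qC z & `|z| = (r%:C)%C) /\
  (forall z : R[i], root qC z -> `|z| <= (r%:C)%C).

End Defs.

(* Main.v *)
Require Import Defs.
From HB Require Import structures.
From mathcomp Require Import all_boot all_order all_algebra.
From mathcomp Require Import all_classical all_reals all_analysis.
From mathcomp Require Import complex.
From mathcomp Require Import ring lra.
Import Order.TTheory GRing.Theory Num.Theory.
Import numFieldNormedType.Exports.
Import ComplexField.Normc.
Local Open Scope classical_set_scope.
Local Open Scope ring_scope.
Set Implicit Arguments. Unset Strict Implicit. Unset Printing Implicit Defensive.

(** Write [P = I - L], a row stochastic matrix with stationary row [w], and [S], a
    column stochastic matrix with fixed column [v].  It suffices that [M] has no
    eigenvector of total mass zero for an eigenvalue [l] with [1 <= |l|]: on the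
    invariant hyperplane of total mass zero the powers of [M] then tend to zero, by
    Cayley-Hamilton and one factor [M - l] at a time.

    The key is that [P] and [S] are contractions (for the sup norm and the l1 norm), so
    that on the hyperplanes [w x = 0] and [1 s = 0] their resolvents at [1 <= |l|] are
    at most [K = 3^(n-1) / (1 - r)], with a single factor [1 / (1 - r)].  Splitting an
    eigenvector [(x, s)] as [x = x0 + xi 1], [s = s0 + sigma v], the eigenvalue
    equations become
      [(l - P) x0 = eps (s - (w s) 1)],  [(l - S) s0 = (1 - l) (x - (1 x) v)],
      [(l - 1 + n eps (w v)) xi = eps (w s0 - (w v) (1 x0))],
    and these force [x = s = 0] once [30 n K^2 eps <= 1]. *)

(** * The modulus of complex numbers, with values in the real field *)

Section Modulus.
Variable R : rcfType.
Implicit Types z w : R[i].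

Lemma normc_ge0 z : 0 <= normc z.
Proof. by case: z => x y; apply: sqrtr_ge0. Qed.

Lemma normc_real (x : R) : normc x%:C%C = `|x|.
Proof. by rewrite /normc /= expr0n addr0 sqrtr_sqr. Qed.

Lemma normc_conj z : normc (conjc z) = normc z.
Proof. by case: z => x y; rewrite /normc /= sqrrN. Qed.

Lemma sqr_normc_Re_Im z : normc z ^+ 2 = complex.Re z ^+ 2 + complex.Im z ^+ 2.
Proof. by case: z => x y; rewrite sqr_sqrtr // addr_ge0 ?sqr_ge0. Qed.

Lemma normc_le_sqr z w : (normc z <= normc w) = (normc z ^+ 2 <= normc w ^+ 2).
Proof. by rewrite ler_pXn2r // nnegrE normc_ge0. Qed.

Lemma normcB_le z w : normc (z - w) <= normc z + normc w.
Proof. by rewrite -(normcN w) le_normcD. Qed.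

Lemma normc_sum_le (I : Type) (s : seq I) (P : pred I) (F : I -> R[i]) :
  normc (\sum_(i <- s | P i) F i) <= \sum_(i <- s | P i) normc (F i).
Proof.
elim/big_rec2: _ => [|i x z _ le_zx]; first by rewrite normc0.
by apply: le_trans (le_normcD _ _) _; rewrite lerD2l.
Qed.

(** The two squared moduli differ by [(|z|^2 - 1) * (1 - |l|^2)]. For [|l| < 1] this bounds by 1 the
    inverse of the Blaschke factor outside the unit disk. *)
Lemma normc_subV_ge z l :
  1 <= normc z -> normc l <= 1 -> normc (1 - conjc l * z) <= normc (z - l).
Proof.
have sqr_ge1 (x : R) : 1 <= x -> 1 <= x ^+ 2 by move=> ?; rewrite expr_ge1 //; lra.
have sqr_le1 (x : R) : 0 <= x -> x <= 1 -> x ^+ 2 <= 1 by move=> ? ?; rewrite expr_le1.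
move=> /sqr_ge1 z1 /(sqr_le1 _ (normc_ge0 l)) l1.
move: z1 l1; rewrite normc_le_sqr !sqr_normc_Re_Im.
case: z => x y; case: l => u v /= z1 l1; nra.
Qed.

End Modulus.

(** * Resolvents of contractions *)

Section ResolventBound.
Variables (R : rcfType) (n : nat).
Implicit Types (N : 'cV[R[i]]_n.+1 -> R) (T : 'M[R[i]]_n.+1).

(** The norm stays abstract so that one resolvent bound serves both the sup norm (for [P]) and the
    l1 norm (for [S]). *)
Definition is_vnorm N :=
  [/\ forall x y, N (x + y) <= N x + N y,
      forall c x, N (c *: x) = normc c * N x &
      forall x, N x = 0 -> x = 0].

Lemma vnorm0 N : is_vnorm N -> N 0 = 0.
Proof. by case=> _ NZ _; rewrite -(scale0r (0 : 'cV_n.+1)) NZ normc0 mul0r. Qed.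

Lemma vnormN N x : is_vnorm N -> N (- x) = N x.
Proof. by case=> _ NZ _; rewrite -scaleN1r NZ normcN normc1 mul1r. Qed.

Lemma vnormB N x y : is_vnorm N -> N (x - y) <= N x + N y.
Proof. by move=> hN; rewrite -(vnormN y hN); case: hN. Qed.

Lemma vnorm_ge0 N x : is_vnorm N -> 0 <= N x.
Proof.
move=> hN; have := vnormB x x hN; rewrite subrr vnorm0 //; lra.
Qed.

(** A kernel vector would satisfy [x = c T x], hence [N x <= |c| N x]. *)
Lemma contraction_sub_unit N T (c : R[i]) : is_vnorm N ->
  (forall x, N (T *m x) <= N x) -> normc c < 1 -> (1%:M - c *: T) \in unitmx.
Proof.
move=> hN hT hc; rewrite -unitmx_tr unitmxE unitfE; apply/negP => /det0P[v v0 vE].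
have {}vE : v^T = c *: (T *m v^T).
  move: vE => /(congr1 trmx); rewrite trmx_mul trmxK trmx0 mulmxBl mul1mx -scalemxAl.
  by move/eqP; rewrite subr_eq0 => /eqP.
case: (hN) => _ NZ N0.
have v_ge0 := vnorm_ge0 v^T hN.
have le_v : N v^T <= normc c * N v^T.
  by rewrite {1}vE NZ ler_wpM2l ?normc_ge0.
suff : N v^T = 0 by move/N0 => /(congr1 trmx); rewrite trmxK trmx0 => vz; rewrite vz eqxx in v0.
by apply/eqP; rewrite eq_le v_ge0 andbT; nra.
Qed.

(* Applying the Blaschke factor [(T - l) / (1 - conj l * T)], whose norm is at most 3
   because [T] is a contraction, removes the eigenvalue [l]; applying [T - l] instead
   would cost a factor [1 / (1 - r)] for each eigenvalue. *)
Lemma resolvent_bound N T (r : R) (z : R[i]) (s : seq R[i]) y :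
  is_vnorm N -> (forall x, N (T *m x) <= N x) -> r < 1 -> 1 <= normc z ->
  {in s, forall l, normc l <= r} ->
  (\prod_(l <- s) (T - l%:M)) *m y = 0 ->
  N y <= (3 ^+ size s - 1) / (1 - r) * N (z *: y - T *m y).
Proof.
move=> hN hT r1 z1; have [ND NZ N0] := hN.
elim: s y => [|l s IHs] y hs.
  rewrite big_nil -[X in X *m _]/(1%:M) mul1mx => ->.
  by rewrite vnorm0 // expr0 subrr !mul0r.
rewrite big_cons -[X in X *m _]/(_ *m _) -mulmxA => hy.
have lr : normc l <= r by apply: hs; rewrite mem_head.
have {}hs : {in s, forall l, normc l <= r} by move=> k ks; apply: hs; rewrite inE ks orbT.
have l1 : normc l < 1 by apply: le_lt_trans r1.
have l0 := normc_ge0 l.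
have normc_1_sub_sqr : normc (1 - l * conjc l) = 1 - normc l ^+ 2.
  have -> : 1 - l * conjc l = (1 - normc l ^+ 2)%:C%C.
    rewrite sqr_normc_Re_Im; case: (l) => a b; apply/eqP; rewrite eq_complex /=.
    by apply/andP; split; apply/eqP; ring.
  rewrite normc_real ger0_norm //; nra.
pose U := 1%:M - conjc l *: T.
have U_unit : U \in unitmx by apply: contraction_sub_unit hN hT _; rewrite normc_conj.
set Q := \prod_(k <- s) _ in IHs hy *.
have TQ : T *m Q = Q *m T.
  apply: commr_prod => k _; rewrite /GRing.comm mulrBl mulrBr.
  by congr (_ - _); apply: scalar_mxC.
have UQ : U *m Q = Q *m U.
  by rewrite /U mulmxBl mulmxBr mul1mx mulmx1 -scalemxAl -scalemxAr TQ.
(* Everything below is written through [u]: [y'] is the Blaschke factor applied to [y], and [g] is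
   [U^-1 f] for the residual [f] of [y]. *)
pose u := invmx U *m y.
have yE : y = U *m u by rewrite /u mulKVmx.
pose g := z *: u - T *m u; pose f := z *: y - T *m y.
have UT : U *m T = T *m U.
  by rewrite /U mulmxBl mulmxBr mul1mx mulmx1 -scalemxAl -scalemxAr.
have fE : f = U *m g.
  by rewrite /f /g yE mulmxBr -scalemxAr !mulmxA UT.
pose y' := T *m u - l *: u.
have gE : g = f + conjc l *: (T *m g).
  by rewrite fE /U mulmxBl mul1mx -scalemxAl subrK.
have f0 := vnorm_ge0 f hN; have g0 := vnorm_ge0 g hN.
(* The contraction gives [(1 - |l|) N g <= N f]; multiplying by [1 + |l|] produces the weight
   [1 - |l|^2] that [g] carries in both uses below. *)
have Ng2 : (1 - normc l ^+ 2) * N g <= (1 + normc l) * N f.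
  have : N g <= N f + normc l * N g.
    rewrite {1}gE; apply: le_trans (ND _ _) _; rewrite NZ normc_conj lerD2l.
    by rewrite ler_wpM2l.
  have -> : 1 - normc l ^+ 2 = (1 + normc l) * (1 - normc l) by ring.
  move=> Ng; rewrite -mulrA ler_pM2l; lra.
have y'E : N (z *: y' - T *m y') <= 3 * N f.
  (* Replacing [l g] by [l f + |l|^2 T g] puts the weight [1 - |l|^2] on [T g], which offsets the
     growth of [g] as [|l|] tends to 1. The total is [(1 + |l|) + |l| <= 3]. *)
  have -> : z *: y' - T *m y' = (1 - l * conjc l) *: (T *m g) - l *: f.
    have -> : z *: y' - T *m y' = T *m g - l *: g.
      rewrite /y' /g !mulmxBr -!scalemxAr; move: (T *m (T *m u)) (T *m u) => A B.
      by apply/matrixP => i j; rewrite !mxE; ring.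
    rewrite {2}gE scalerDr scalerBl scale1r scalerA opprD addrA addrAC; congr (_ - _).
  apply: le_trans (vnormB _ _ hN) _; rewrite !NZ.
  rewrite normc_1_sub_sqr.
  have Tg := hT g; have Tg0 := vnorm_ge0 (T *m g) hN.
  have le1 : (1 - normc l ^+ 2) * N (T *m g) <= (1 - normc l ^+ 2) * N g.
    by rewrite ler_wpM2l //; nra.
  have : normc l * N f <= 1 * N f by rewrite ler_wpM2r // ltW.
  nra.
have Qy' : Q *m y' = 0.
  apply: (can_inj (mulKmx U_unit)); rewrite mulmx0 mulmxA UQ -mulmxA.
  have -> : U *m y' = (T - l%:M) *m y.
    by rewrite /y' mulmxBr -scalemxAr mulmxA UT -mulmxA -yE mulmxBl mul_scalar_mx.
  rewrite -[RHS]hy !mulmxA; congr (_ *m _).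
  by rewrite mulmxBl mulmxBr TQ scalar_mxC.
have IH := IHs y' hs Qy'.
(* By [normc_subV_ge] the coefficient of [y'] is at most [|z - l|], so the division by [z - l] costs
   [1 / (1 - r)] only on the [g] term. *)
have eqy : (z - l) *: y = (1 - conjc l * z) *: y' + (1 - l * conjc l) *: g.
  rewrite yE /U /y' /g mulmxBl mul1mx -scalemxAl; move: (T *m u) => A.
  by apply/matrixP => i j; rewrite !mxE; ring.
have NyE : normc (z - l) * N y <= normc (z - l) * N y' + (1 + normc l) * N f.
  rewrite -NZ eqy; apply: le_trans (ND _ _) _; rewrite !NZ lerD //.
    by rewrite ler_wpM2r ?vnorm_ge0 // normc_subV_ge // ltW.
  by rewrite normc_1_sub_sqr.
have zl : 1 - r <= normc (z - l).
  have := le_normcD (z - l) l; rewrite subrK; lra.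
set K := (3 ^+ size s - 1) / (1 - r) in IH.
have K0 : 0 <= K.
  by rewrite divr_ge0 ?subr_ge0 ?exprn_ege1 // ?ltW //; lra.
(* The constant solves [K_0 = 0], [K_(m+1) = 3 K_m + 2 / (1 - r)]. *)
have -> : (3 ^+ size (l :: s) - 1) / (1 - r) = 3 * K + 2 / (1 - r).
  rewrite /K /= exprS; field; lra.
rewrite -/f.
have zl0 : 0 < normc (z - l) by lra.
have hd : normc (z - l) * N y <= normc (z - l) * (3 * K * N f + 2 / (1 - r) * N f).
  apply: le_trans NyE _; rewrite mulrDr lerD //.
    rewrite ler_pM2l //; apply: le_trans IH _.
    by rewrite [3 * K]mulrC -[leRHS]mulrA ler_wpM2l.
  have h2 : (1 - r) * (2 / (1 - r)) = 2 by field; lra.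
  have h3 : 0 <= 2 / (1 - r) by apply: divr_ge0; lra.
  rewrite mulrA ler_wpM2r //; nra.
by rewrite mulrDl -(ler_pM2l zl0).
Qed.

End ResolventBound.

(** * The sup norm and the l1 norm of complex columns *)

Section VectorNorms.
Variables (R : realType) (n : nat).
Implicit Types x y : 'cV[R[i]]_n.+1.

Definition norm_inf x : R := \big[Num.max/0]_i normc (x i 0).
Definition norm_one x : R := \sum_i normc (x i 0).

Lemma normc_le_norm_inf x i : normc (x i 0) <= norm_inf x.
Proof. exact: (@le_bigmax _ _ _ _ (fun i => normc (x i 0))). Qed.

Lemma norm_inf_le x (c : R) :
  0 <= c -> (forall i, normc (x i 0) <= c) -> norm_inf x <= c.
Proof. by move=> c0 xc; apply: bigmax_le. Qed.

Lemma norm_inf_ge0 x : 0 <= norm_inf x.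
Proof. exact: le_trans (normc_ge0 _) (normc_le_norm_inf x 0). Qed.

Lemma norm_infP : is_vnorm norm_inf.
Proof.
split=> [x y|c x|x x0].
- apply: norm_inf_le => [|i]; first by rewrite addr_ge0 ?norm_inf_ge0.
  by rewrite mxE; apply: le_trans (le_normcD _ _) _; rewrite lerD ?normc_le_norm_inf.
- apply/eqP; rewrite eq_le; apply/andP; split.
    apply: norm_inf_le => [|i]; first by rewrite mulr_ge0 ?norm_inf_ge0 ?normc_ge0.
    by rewrite mxE normcM ler_wpM2l ?normc_ge0 ?normc_le_norm_inf.
  have [->|c0] := eqVneq c 0; first by rewrite normc0 mul0r norm_inf_ge0.
  have nc0 : 0 < normc c.
    by rewrite lt_def normc_ge0 andbT; apply: contra_neq c0 => /eq0_normc.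
  rewrite mulrC -ler_pdivlMr //; apply: norm_inf_le => [|i].
    by rewrite divr_ge0 ?norm_inf_ge0 ?normc_ge0.
  rewrite ler_pdivlMr // mulrC -normcM.
  by have := normc_le_norm_inf (c *: x) i; rewrite mxE.
- apply/matrixP => i j; rewrite ord1 mxE; apply: eq0_normc.
  by apply/eqP; rewrite eq_le normc_ge0 andbT -x0 normc_le_norm_inf.
Qed.

Lemma norm_oneP : is_vnorm norm_one.
Proof.
split=> [x y|c x|x x0].
- by rewrite -big_split; apply: ler_sum => i _; rewrite mxE le_normcD.
- by rewrite mulr_sumr; apply: eq_bigr => i _; rewrite mxE normcM.
- apply/matrixP => i j; rewrite ord1 mxE; apply: eq0_normc.
  by apply: (psumr_eq0P _ x0) => // k _; apply: normc_ge0.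
Qed.

Lemma normc_le_norm_one x i : normc (x i 0) <= norm_one x.
Proof.
rewrite /norm_one (bigD1 i) //= lerDl sumr_ge0 // => k _; exact: normc_ge0.
Qed.

Lemma normc_sum_le_norm_one x : normc (\sum_i x i 0) <= norm_one x.
Proof. exact: normc_sum_le. Qed.

Lemma norm_one_le_norm_inf x : norm_one x <= n.+1%:R * norm_inf x.
Proof.
apply: (@le_trans _ _ (\sum_(i < n.+1) norm_inf x)).
  by apply: ler_sum => i _; apply: normc_le_norm_inf.
by rewrite sumr_const card_ord mulr_natl.
Qed.

Lemma norm_inf_le_norm_one x : norm_inf x <= norm_one x.
Proof.
apply: norm_inf_le => [|i]; last exact: normc_le_norm_one.
by apply: sumr_ge0 => i _; apply: normc_ge0.
Qed.

End VectorNorms.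

Notation map_complex := (map_mx (real_complex _)).

(** * Irreducible stochastic matrices: contraction and fixed vectors *)

Section Stochastic.
Variables (R : realType) (n : nat).
Implicit Types (P : 'M[R]_n.+1) (w : 'rV[R]_n.+1).

Definition stochastic P :=
  (forall i j, 0 <= P i j) /\ (forall i, \sum_j P i j = 1).

Definition irreducible P := forall i j, connect (fun i j => 0 < P i j) i j.

Lemma stochastic_const P : stochastic P -> P *m const_mx 1 = const_mx 1 :> 'cV_n.+1.
Proof.
move=> [_ P1]; apply/matrixP => i j; rewrite !mxE -[RHS](P1 i).
by apply: eq_bigr => k _; rewrite mxE mulr1.
Qed.

Lemma norm_inf_stochastic P x :
  stochastic P -> norm_inf (map_complex P *m x) <= norm_inf x.
Proof.
move=> [P0 P1]; apply: norm_inf_le => [|i]; first exact: norm_inf_ge0.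
rewrite mxE; apply: le_trans (normc_sum_le _ _ _) _.
rewrite -[leRHS]mul1r -(P1 i) mulr_suml; apply: ler_sum => j _.
by rewrite mxE normcM normc_real ger0_norm // ler_wpM2l ?normc_le_norm_inf.
Qed.

Lemma norm_one_stochastic P x :
  stochastic P -> norm_one (map_complex P^T *m x) <= norm_one x.
Proof.
move=> [P0 P1]; rewrite /norm_one.
apply: (@le_trans _ _ (\sum_i \sum_j P j i * normc (x j 0))).
  apply: ler_sum => i _; rewrite mxE; apply: le_trans (normc_sum_le _ _ _) _.
  by apply: ler_sum => j _; rewrite !mxE normcM normc_real ger0_norm.
rewrite exchange_big /=; apply: ler_sum => j _.
by rewrite -mulr_suml P1 mul1r.
Qed.

(** A left eigenvector, transposed, is an eigenvector of [P^T], which is an l1 contraction. *)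
Lemma stochastic_eigenvalue_le1 P (z : R[i]) :
  stochastic P -> root (map_poly (real_complex R) (char_poly P)) z -> normc z <= 1.
Proof.
move=> hP; rewrite map_char_poly -eigenvalue_root_char => /eigenvalueP[v vE v0].
have hN := norm_oneP R n; have [_ NZ N0] := hN.
have := norm_one_stochastic v^T hP; rewrite -map_trmx -trmx_mul vE linearZ /= NZ.
rewrite ger_pMl // lt_def vnorm_ge0 // andbT; apply: contra_neq v0 => /N0 vT0.
by rewrite -[v]trmxK vT0 trmx0.
Qed.

(** The triangle inequality gives [<=] for each [j]. Both sides have the same sum over [j], since
    the rows of [P] sum to 1, so no inequality is strict. *)
Lemma left_fixed_abs P w : stochastic P -> w *m P = w ->
  forall j, `|w 0 j| = \sum_k `|w 0 k| * P k j.
Proof.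
move=> [P0 P1] wP j.
have abs_le k : `|w 0 k| <= \sum_l `|w 0 l| * P l k.
  rewrite -{1}wP mxE; apply: le_trans (ler_norm_sum _ _ _) _.
  by apply: ler_sum => l _; rewrite normrM [`|P _ _|]ger0_norm.
apply/esym/eqP; rewrite -subr_eq0; apply/eqP.
apply: (@psumr_eq0P _ _ xpredT (fun j => \sum_k `|w 0 k| * P k j - `|w 0 j|)) => //.
  by move=> k _; rewrite subr_ge0.
rewrite big_split /= exchange_big /= sumrN -sumrB big1 // => k _.
by rewrite -mulr_sumr P1 mulr1 subrr.
Qed.

(** By [left_fixed_abs], a zero at [j] forces a zero at every [k] with [0 < P k j]; irreducibility
    spreads it to all indices. *)
Lemma left_fixed_eq0 P w i :
  stochastic P -> irreducible P -> w *m P = w -> w 0 i = 0 -> w = 0.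
Proof.
move=> hP Pirr wP wi0; have [P0 P1] := hP.
have abs_eq := left_fixed_abs hP wP.
have back j k : 0 < P k j -> w 0 j = 0 -> w 0 k = 0.
  move=> Pkj wj0; have := abs_eq j; rewrite wj0 normr0 => /esym sum0.
  have ge0 l : true -> 0 <= `|w 0 l| * P l j by rewrite mulr_ge0.
  have /eqP : `|w 0 k| * P k j = 0 by apply: (psumr_eq0P ge0 sum0).
  by rewrite mulf_eq0 normr_eq0 (gt_eqF Pkj) orbF => /eqP.
apply/matrixP => o j; rewrite ord1 mxE {o}.
have /connectP[p] := Pirr j i.
elim: p j => [|k p IHp] j /=; first by move=> _ <-.
move=> /andP[Pjk kp] iE; exact: back Pjk (IHp k kp iE).
Qed.

(** Maximum principle: each entry is an average of the entries at its successors, so a maximum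
    propagates along the edges. *)
Lemma right_fixed_const P (x : 'cV[R]_n.+1) i j :
  stochastic P -> irreducible P -> P *m x = x -> x i 0 = x j 0.
Proof.
move=> [P0 P1] Pirr Px.
pose k := [arg max_(k > ord0) x k 0]%O.
have max_k l : x l 0 <= x k 0 by rewrite /k; case: arg_maxP => // m _; apply.
have forw l m : 0 < P l m -> x l 0 = x k 0 -> x m 0 = x k 0.
  move=> Plm xl.
  have sum0 : \sum_h P l h * (x k 0 - x h 0) = 0.
    under eq_bigr do rewrite mulrBr.
    rewrite sumrB -mulr_suml P1 mul1r -{1}xl -{1}Px mxE subrr //.
  have ge0 h : true -> 0 <= P l h * (x k 0 - x h 0).
    by move=> _; rewrite mulr_ge0 // subr_ge0.
  have /eqP : P l m * (x k 0 - x m 0) = 0 by apply: (psumr_eq0P ge0 sum0).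
  by rewrite mulf_eq0 (gt_eqF Plm) subr_eq0 => /eqP.
suff all_max l : x l 0 = x k 0 by rewrite !all_max.
have along p : forall h, x h 0 = x k 0 ->
    path (fun i j => 0 < P i j) h p -> x (last h p) 0 = x k 0.
  elim: p => [|m p IHp] h //= xh /andP[Phm mp].
  by apply: IHp mp; apply: forw Phm xh.
by have /connectP[p kp ->] := Pirr k l; apply: along.
Qed.

(** [P - 1] kills the constant column, so it has a left kernel row. The absolute values of that row
    are again fixed and have no zero; it remains to normalise them. *)
Lemma stationary_exists P : stochastic P -> irreducible P ->
  exists w, [/\ w *m P = w, forall i, 0 < w 0 i & \sum_i w 0 i = 1].
Proof.
move=> hP Pirr; have [P0 P1] := hP.
have /det0P[w w0 wP] : \det (P - 1%:M) == 0.
  rewrite -[_ == 0]negbK -unitfE -unitmxE; apply/negP => U.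
  have : (P - 1%:M) *m const_mx 1 = 0 :> 'cV_n.+1.
    by rewrite mulmxBl mul1mx stochastic_const // subrr.
  move=> /(congr1 (mulmx (invmx (P - 1%:M)))); rewrite mulKmx // mulmx0.
  by move=> /matrixP/(_ 0 0)/eqP; rewrite !mxE oner_eq0.
have {}wP : w *m P = w.
  by move: wP; rewrite mulmxBr mulmx1 => /eqP; rewrite subr_eq0 => /eqP.
have abs_eq := left_fixed_abs hP wP.
have pos i : 0 < `|w 0 i|.
  rewrite normr_gt0; apply: contra_neq w0; exact: left_fixed_eq0.
have W0 : 0 < \sum_i `|w 0 i|.
  by rewrite (bigD1 0) //= ltr_wpDr // sumr_ge0.
exists (\row_i (`|w 0 i| / \sum_i `|w 0 i|)); split.
- apply/rowP => j; rewrite !mxE {1}abs_eq mulr_suml; apply: eq_bigr => k _.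
  by rewrite !mxE mulrAC.
- by move=> i; rewrite mxE divr_gt0.
- under eq_bigr do rewrite mxE.
  by rewrite -mulr_suml divff // gt_eqF.
Qed.

(** Columns of [H] are right fixed, hence constant; a row minus the multiple of [w] that agrees with
    it at index 0 is left fixed with a zero, hence null. Such an [H] kills every [x] with
    [w x = 0]. *)
Lemma two_sided_fixed P (H : 'M[R]_n.+1) w :
  stochastic P -> irreducible P -> w *m P = w -> (forall i, 0 < w 0 i) ->
  P *m H = H -> H *m P = H -> exists c, forall i j, H i j = c * w 0 j.
Proof.
move=> hP Pirr wP w0 PH HP; exists (H 0 0 / w 0 0) => i j.
have -> : H i j = H 0 j.
  have := @right_fixed_const P (col j H) i 0 hP Pirr; rewrite !mxE; apply.
  by rewrite colE mulmxA PH.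
have /matrixP/(_ 0 j) : row 0 H - (H 0 0 / w 0 0) *: w = 0.
  apply: (left_fixed_eq0 (P := P) (i := 0)) => //.
    by rewrite mulmxBl -scalemxAl wP -row_mul HP.
  by rewrite !mxE divfK ?subrr // gt_eqF.
by rewrite !mxE => /eqP; rewrite subr_eq0 => /eqP.
Qed.

End Stochastic.

(** * Splitting one factor [X - 1] off a characteristic polynomial *)

Section SplitCharPoly.
Variables (R : realType) (n : nat).

Lemma char_poly_tr (F : comNzRingType) m (A : 'M[F]_m) : char_poly A^T = char_poly A.
Proof.
rewrite /char_poly -[RHS]det_tr; congr (\det _).
by apply/matrixP => i j; rewrite !mxE eq_sym.
Qed.

(** Cayley-Hamilton reads [(T - 1) q(T) = 0 = q(T) (T - 1)], so [T] fixes [q(T)] on both sides. [s]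
    lists the complex roots of [q] with multiplicity, one fewer than the dimension [n.+1]. *)
Lemma splitting_char_poly (T : 'M[R]_n.+1) : root (char_poly T) 1 ->
  exists q (s : seq R[i]),
    [/\ char_poly T = q * ('X - 1), size s = n,
        forall z, root (map_poly (real_complex R) q) z = (z \in s),
        T *m horner_mx T q = horner_mx T q /\ horner_mx T q *m T = horner_mx T q &
        \prod_(l <- s) (map_complex T - l%:M) = map_complex (horner_mx T q)].
Proof.
move=> /factor_theorem[q qE]; rewrite polyC1 in qE; exists q.
have [s sE] := closed_field_poly_normal (map_poly (real_complex R) q).
have X1 : ('X - 1 : {poly R}) \is monic by rewrite -polyC1 monicXsubC.
have qm : q \is monic by rewrite -(monicMr _ X1) -qE char_poly_monic.
have size_q : size q = n.+1.
  have := size_char_poly T; rewrite qE size_Mmonic ?monic_neq0 //.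
  by rewrite -polyC1 size_XsubC addn2 /= => -[].
rewrite lead_coef_map (monicP qm) rmorph1 scale1r in sE.
have CH : horner_mx T q *m (T - 1%:M) = 0.
  have := Cayley_Hamilton T; rewrite qE rmorphM rmorphB /= horner_mx_X rmorph1 //.
have CH' : (T - 1%:M) *m horner_mx T q = 0.
  have := Cayley_Hamilton T; rewrite qE mulrC rmorphM rmorphB /= horner_mx_X rmorph1 //.
exists s; split=> //.
- have := size_map_poly (real_complex R) q.
  by rewrite sE size_prod_XsubC size_q => -[].
- by move=> z; rewrite sE root_prod_XsubC.
- split; apply/eqP; rewrite -subr_eq0.
    by rewrite -[X in _ - X]mul1mx -mulmxBl CH'.
  by rewrite -[X in _ - X]mulmx1 -mulmxBr CH.
- rewrite map_horner_mx sE rmorph_prod; apply: eq_bigr => l _.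
  by rewrite rmorphB /= horner_mx_X horner_mx_C.
Qed.

End SplitCharPoly.

(** * Scalar inequalities for the eigenvector estimate *)

Section Estimates.
Variable R : realType.
Implicit Types X Y Z A m D eps om K N c : R.

Lemma shifted_modulus_ge (l : R[i]) c : 1 <= normc l -> 0 <= c -> c <= 3 / 4 ->
  c <= normc (l - 1 + c%:C%C) /\ normc (l - 1) / 2 <= normc (l - 1 + c%:C%C).
Proof.
move=> l1 c0 c34; have n0 := normc_ge0 (l - 1 + c%:C%C).
have m0 := normc_ge0 (l - 1).
have : 1 <= normc l ^+ 2 by rewrite expr_ge1 //; lra.
have nE := sqr_normc_Re_Im (l - 1 + c%:C%C); have mE := sqr_normc_Re_Im (l - 1).
rewrite sqr_normc_Re_Im; move: (normc _) (normc (l - 1)) n0 m0 nE mE => D m D0 m0.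
case: l {l1} => x y /=; rewrite subr0 addr0 => DE mE l1.
(* Here [D^2 = m^2 + 2 c (x - 1) + c^2], and [|l| >= 1] gives [2 (x - 1) >= - m^2]. The bound
   [c <= 3/4] then leaves [1 - c >= 1/4], whence the factor [1/2] on [m]. *)
have D2 : D ^+ 2 >= m ^+ 2 * (1 - c) + c ^+ 2 by rewrite DE mE; nra.
have m2 : 0 <= m ^+ 2 by rewrite sqr_ge0.
split; rewrite -(ler_pXn2r (n := 2)) ?nnegrE //; nra.
Qed.

Lemma shift_small eps om K N : om <= 1 -> 3 <= K -> 0 <= N -> 0 < eps ->
  30 * N * K ^+ 2 * eps <= 1 -> N * eps * om <= 3 / 4.
Proof.
move=> om1 K3 N0 eps0 small.
have ne0 : 0 <= N * eps by rewrite mulr_ge0 // ltW.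
have K2 : 9 <= K ^+ 2.
  by rewrite (_ : 9 = 3 ^+ 2); [rewrite ler_pXn2r // nnegrE; lra | ring].
have : N * eps * om <= N * eps * 1 by rewrite ler_wpM2l.
have : N * eps * 9 <= N * eps * K ^+ 2 by rewrite ler_wpM2l.
lra.
Qed.

(** [X], [Y], [Z], [A] stand for the norms of [x0], [xi], [s0] and [t = x - (1 x) v], [m] for
    [|l - 1|], [D] for [|l - 1 + N eps om|], and [N] for the dimension. The bound on [Z] with the
    factor [m] serves for [Y], where [m <= 2 D] cancels the division by [D]; the other one serves
    for [X]. *)
Lemma estimates_trivial X Y Z A m D eps om K N :
  0 <= X -> 0 <= Y -> 0 <= Z -> 0 <= m -> 0 < D -> 0 < eps -> 0 < om -> 3 <= K -> 1 <= N ->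
  30 * N * K ^+ 2 * eps <= 1 ->
  N * eps * om <= D -> m / 2 <= D ->
  A <= 2 * N * (X + Y) -> Z <= K * (m * A) -> Z <= (1 + 2 * K) * A ->
  X <= K * (2 * eps * (Z + N * (X + Y))) -> Y * D <= eps * (Z + om * (N * X)) ->
  [/\ X = 0, Y = 0 & Z = 0].
Proof.
move=> X0 Y0 Z0 m0 D0 eps0 om0 K3 N1 small cD mD hA hZ1 hZ2 hX hY.
pose B := N * K * eps.
have B0 : 0 <= B by rewrite /B !mulr_ge0 //; lra.
have KB : 30 * (K * B) <= 1 by rewrite /B; nra.
have B90 : 90 * B <= 1 by nra.
set W := X + Y in hA hX; have W0 : 0 <= W by rewrite addr_ge0.
have BW0 : 0 <= B * W by rewrite mulr_ge0.
have hY' : Y <= 4 * (B * W) + X.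
  rewrite -(ler_pM2r D0); apply: le_trans hY _; rewrite mulrDr mulrDl lerD //.
    have h : eps * Z <= eps * (K * (m * (2 * N * W))).
      rewrite ler_pM2l //; apply: le_trans hZ1 _.
      by rewrite ler_wpM2l ?ler_wpM2l //; lra.
    have -> : 4 * (B * W) * D = eps * (K * (2 * D * (2 * N * W))) by rewrite /B; ring.
    apply: le_trans h _; rewrite ler_pM2l // ler_wpM2l //; first lra.
    by rewrite ler_wpM2r //; [rewrite !mulr_ge0 //; lra | lra].
  have -> : eps * (om * (N * X)) = (N * eps * om) * X by ring.
  by rewrite [X * D]mulrC ler_wpM2r.
have BW : 90 * (B * W) <= W by rewrite mulrA -[leRHS]mul1r ler_wpM2r.
have KBW : 30 * (K * B * W) <= W by rewrite mulrA -[leRHS]mul1r ler_wpM2r.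
(* [K >= 3] gives [1 + 2 K <= 7 / 3 K]. *)
have hZ : K * eps * Z <= 14 / 3 * (K * B * W).
  have -> : 14 / 3 * (K * B * W) = K * eps * ((7 / 3 * K) * (2 * N * W)).
    by rewrite /B; field.
  rewrite ler_wpM2l //; first by rewrite mulr_ge0 //; lra.
  apply: le_trans hZ2 _; apply: (@le_trans _ _ ((1 + 2 * K) * (2 * N * W))).
    by rewrite ler_wpM2l //; lra.
  by rewrite ler_wpM2r //; [rewrite !mulr_ge0 //; lra | lra].
have hX' : X <= 2 * (K * eps * Z) + 2 * (B * W).
  by apply: le_trans hX _; rewrite /B le_eqVlt; apply/orP; left; apply/eqP; ring.
have WE : W = X + Y by [].
(* Now [X <= W / 3] and [Y <= 4 W / 90 + X], so [W <= 64 W / 90], which forces [W <= 0]. *)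
have X00 : X = 0 by apply/eqP; rewrite eq_le X0 andbT; lra.
have Y00 : Y = 0 by apply/eqP; rewrite eq_le Y0 andbT; lra.
split=> //; have W00 : W = 0 by rewrite WE X00 Y00 addr0.
rewrite W00 in hA; apply/eqP; rewrite eq_le Z0 andbT; apply: le_trans hZ2 _.
by rewrite pmulr_rle0; lra.
Qed.

End Estimates.

(** * No eigenvector of total mass zero for [1 <= |l|] *)

Section KernelTrivial.
Variables (R : realType) (n : nat).
Implicit Types (u : 'rV[R[i]]_n.+1) (x y : 'cV[R[i]]_n.+1).

Definition dot u x : R[i] := (u *m x) 0 0.

Lemma dotD u x y : dot u (x + y) = dot u x + dot u y.
Proof. by rewrite /dot mulmxDr mxE. Qed.
Lemma dotB u x y : dot u (x - y) = dot u x - dot u y.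
Proof. by rewrite /dot mulmxBr !mxE. Qed.
Lemma dotZ u c x : dot u (c *: x) = c * dot u x.
Proof. by rewrite /dot -scalemxAr mxE. Qed.
Lemma dotM u A x : dot u (A *m x) = dot (u *m A) x.
Proof. by rewrite /dot mulmxA. Qed.
Lemma dot_const1 x : dot (const_mx 1) x = \sum_i x i 0.
Proof. by rewrite /dot mxE; apply: eq_bigr => i _; rewrite mxE mul1r. Qed.

Lemma normc_dot_le (w : 'rV[R]_n.+1) x :
  (forall i, 0 < w 0 i) -> \sum_i w 0 i = 1 ->
  normc (dot (map_complex w) x) <= norm_inf x.
Proof.
move=> w0 w1; rewrite /dot mxE; apply: le_trans (normc_sum_le _ _ _) _.
rewrite -[leRHS]mul1r -w1 mulr_suml; apply: ler_sum => i _.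
by rewrite mxE normcM normc_real gtr0_norm // ler_wpM2l ?normc_le_norm_inf // ltW.
Qed.

Variables (P Q : 'M[R]_n.+1) (w v : 'rV[R]_n.+1) (K eps : R) (l : R[i]).
Hypotheses (hP : stochastic P) (hQ : stochastic Q).
Hypotheses (wP : w *m P = w) (w_gt0 : forall i, 0 < w 0 i) (w1 : \sum_i w 0 i = 1).
Hypotheses (vQ : v *m Q = v) (v_gt0 : forall i, 0 < v 0 i) (v1 : \sum_i v 0 i = 1).
Hypotheses (K3 : 3 <= K) (eps0 : 0 < eps) (small : 30 * n.+1%:R * K ^+ 2 * eps <= 1).
Hypothesis l1 : 1 <= normc l.
Let PC := map_complex P.
Let SC := map_complex Q^T.
Let wC := map_complex w.
Let oC : 'rV[R[i]]_n.+1 := const_mx 1.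
Let eC : 'cV[R[i]]_n.+1 := const_mx 1.
Let vC := map_complex v^T.
Hypothesis resP :
  forall x, dot wC x = 0 -> norm_inf x <= K * norm_inf (l *: x - PC *m x).
Hypothesis resS :
  forall x, dot oC x = 0 -> norm_one x <= K * norm_one (l *: x - SC *m x).

Lemma perturbed_kernel_trivial x s :
  PC *m x + eps%:C%C *: s = l *: x -> x + SC *m s = l *: (x + s) ->
  dot oC (x + s) = 0 -> x = 0 /\ s = 0.
Proof.
move=> eq1 eq2 sum0.
have K0 : 0 <= K by apply: le_trans K3.
have Ninf := norm_infP R n; have None := norm_oneP R n.
have [NiD NiZ Ni0] := Ninf; have [NoD NoZ No0] := None.
have wPC : wC *m PC = wC by rewrite /wC /PC -map_mxM wP.
have PCe : PC *m eC = eC.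
  have /(congr1 (map_complex)) := stochastic_const hP.
  by rewrite map_mxM map_const_mx rmorph1.
have oSC : oC *m SC = oC.
  have /(congr1 (fun A => map_complex (trmx A))) := stochastic_const hQ.
  by rewrite trmx_mul map_mxM trmx_const map_const_mx rmorph1.
have SCv : SC *m vC = vC by rewrite /SC /vC -map_mxM -trmx_mul vQ.
have we : dot wC eC = 1.
  rewrite /dot mxE -[RHS](rmorph1 (real_complex R)) -w1 rmorph_sum.
  by apply: eq_bigr => i _; rewrite !mxE mulr1.
have ov : dot oC vC = 1.
  rewrite dot_const1 -[RHS](rmorph1 (real_complex R)) -v1 rmorph_sum.
  by apply: eq_bigr => i _; rewrite !mxE.
have oe : dot oC eC = n.+1%:R.
  rewrite dot_const1; under eq_bigr do rewrite mxE.
  by rewrite sumr_const card_ord.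
have [om [wv om0]] : exists om, dot wC vC = om%:C%C /\ 0 < om.
  exists (\sum_i w 0 i * v 0 i); split.
    by rewrite /dot mxE rmorph_sum; apply: eq_bigr => i _; rewrite !mxE rmorphM.
  rewrite (bigD1 0) //= ltr_wpDr ?mulr_gt0 // sumr_ge0 // => i _.
  by rewrite mulr_ge0 ?ltW.
have None_v : norm_one vC = 1.
  by rewrite -v1; apply: eq_bigr => i _; rewrite !mxE normc_real gtr0_norm.
have Ninf_e : norm_inf eC <= 1.
  by apply: norm_inf_le => // i; rewrite mxE normc1.
have om1 : om <= 1.
  have := normc_dot_le vC w_gt0 w1; rewrite -/wC wv normc_real gtr0_norm // => h.
  by apply: le_trans h _; rewrite -None_v norm_inf_le_norm_one.
set xi := dot wC x; set sg := dot oC s.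
have sgE : sg = - dot oC x by apply/eqP; rewrite -addr_eq0 addrC -dotD sum0.
pose x0 := x - xi *: eC; pose s0 := s - sg *: vC; pose t := x - dot oC x *: vC.
have wx0 : dot wC x0 = 0 by rewrite dotB dotZ we mulr1 subrr.
have os0 : dot oC s0 = 0 by rewrite dotB dotZ ov mulr1 subrr.
have ot : dot oC t = 0 by rewrite dotB dotZ ov mulr1 subrr.
(* The first equation paired with [w], which [P] fixes. *)
have xi_mu : (l - 1) * xi = eps%:C%C * dot wC s.
  have := congr1 (dot wC) eq1; rewrite dotD dotM wPC !dotZ -/xi => h.
  by rewrite mulrBl mul1r -h addrC addKr.
have eqA : l *: x0 - PC *m x0 = eps%:C%C *: (s - dot wC s *: eC).
  rewrite mulmxBr -scalemxAr PCe scalerBr -eq1 scalerBr [eps%:C%C *: (_ *: _)]scalerA -xi_mu.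
  by move: (PC *m x) => a; apply/matrixP => i j; rewrite !mxE; ring.
have eqB : l *: s0 - SC *m s0 = (1 - l) *: t.
  have Ss : SC *m s = l *: (x + s) - x by rewrite -eq2 addrC addKr.
  rewrite mulmxBr -scalemxAr SCv Ss /s0 /t sgE; move: (dot oC x) => d.
  by apply/matrixP => i j; rewrite !mxE; ring.
(* A variant of [eqB] whose right side does not involve [l]: it bounds [s0] uniformly for large
   [|l|], while the factor [1 - l] in [eqB] helps near [l = 1]. *)
have eqB' : l *: (s0 + t) - SC *m (s0 + t) = t - SC *m t.
  rewrite mulmxDr scalerDr.
  have -> : SC *m s0 = l *: s0 - (1 - l) *: t by rewrite -eqB subKr.
  by move: (SC *m t) => b; apply/matrixP => i j; rewrite !mxE; ring.
pose c := n.+1%:R * eps * om.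
have c0 : 0 < c by rewrite !mulr_gt0.
(* In [xi_mu], expand [w s = w s0 + sg om] with [sg = - (1 x0) - n.+1 xi]; the [xi] term moves to
   the left as [c xi]. *)
have eqC : (l - 1 + c%:C%C) * xi = eps%:C%C * (dot wC s0 - om%:C%C * dot oC x0).
  rewrite mulrDl xi_mu !dotB !dotZ wv oe sgE /c -/xi !rmorphM rmorph_nat.
  ring.
have X0 := norm_inf_ge0 x0; have Z0 := vnorm_ge0 s0 None; have Y0 := normc_ge0 xi.
set X := norm_inf x0 in X0; set Y := normc xi in Y0; set Z := norm_one s0 in Z0.
have n1 : 1 <= n.+1%:R :> R by rewrite ler1n.
have normx : norm_inf x <= X + Y.
  have -> : x = x0 + xi *: eC by rewrite subrK.
  apply: le_trans (NiD _ _) _; rewrite lerD2l NiZ -[leRHS]mulr1.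
  by rewrite ler_wpM2l.
have normx1 : norm_one x <= n.+1%:R * (X + Y).
  by apply: le_trans (norm_one_le_norm_inf x) _; rewrite ler_wpM2l.
have normox : normc (dot oC x) <= n.+1%:R * (X + Y).
  by rewrite dot_const1; apply: le_trans (normc_sum_le_norm_one x) _.
have hA : norm_one t <= 2 * n.+1%:R * (X + Y).
  apply: le_trans (vnormB _ _ None) _; rewrite NoZ None_v mulr1; lra.
have norms : norm_inf s <= Z + n.+1%:R * (X + Y).
  apply: le_trans (norm_inf_le_norm_one s) _.
  have -> : s = s0 + sg *: vC by rewrite subrK.
  by apply: le_trans (NoD _ _) _; rewrite lerD2l NoZ None_v mulr1 sgE normcN.
have hX : X <= K * (2 * eps * (Z + n.+1%:R * (X + Y))).
  apply: le_trans (resP wx0) _; rewrite eqA NiZ normc_real (gtr0_norm eps0).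
  apply: ler_wpM2l => //; rewrite [2 * _]mulrC -[leRHS]mulrA (ler_pM2l eps0).
  apply: le_trans (vnormB _ _ Ninf) _; rewrite NiZ.
  have ws := normc_dot_le s w_gt0 w1; rewrite -/wC in ws.
  have : normc (dot wC s) * norm_inf eC <= normc (dot wC s) * 1.
    by rewrite ler_wpM2l ?normc_ge0.
  lra.
have hZ1 : Z <= K * (normc (l - 1) * norm_one t).
  by apply: le_trans (resS os0) _; rewrite eqB NoZ -normcN opprB.
have hZ2 : Z <= (1 + 2 * K) * norm_one t.
  have ost : dot oC (s0 + t) = 0 by rewrite dotD os0 ot addr0.
  have := resS ost; rewrite eqB' => h.
  have h2 : norm_one (t - SC *m t) <= 2 * norm_one t.
    have := vnormB t (SC *m t) None; have := norm_one_stochastic t hQ; rewrite -/SC; lra.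
  have h3 : norm_one (s0 + t) <= K * (2 * norm_one t).
    by apply: le_trans h _; rewrite ler_wpM2l.
  have : Z <= norm_one (s0 + t) + norm_one t.
    by have := vnormB (s0 + t) t None; rewrite addrK.
  lra.
have c34 : c <= 3 / 4 := shift_small om1 K3 (ler0n _ _) eps0 small.
have [cD mD] := shifted_modulus_ge l1 (ltW c0) c34.
have hY : Y * normc (l - 1 + c%:C%C) <= eps * (Z + om * (n.+1%:R * X)).
  rewrite mulrC /Y -normcM eqC normcM normc_real (gtr0_norm eps0) (ler_pM2l eps0).
  apply: le_trans (normcB_le _ _) (lerD _ _).
    exact: le_trans (normc_dot_le s0 w_gt0 w1) (norm_inf_le_norm_one s0).
  rewrite normcM normc_real (gtr0_norm om0) (ler_pM2l om0) dot_const1.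
  exact: le_trans (normc_sum_le_norm_one x0) (norm_one_le_norm_inf x0).
have D0 : 0 < normc (l - 1 + c%:C%C) by apply: lt_le_trans cD.
have [X00 Y00 Z00] := estimates_trivial X0 Y0 Z0 (normc_ge0 (l - 1)) D0 eps0 om0 K3 n1
  small cD mD hA hZ1 hZ2 hX hY.
have x00 : x = 0.
  by apply: Ni0; apply/eqP; rewrite eq_le norm_inf_ge0 andbT; move: normx; rewrite X00 Y00 addr0.
split=> //; have /No0 := Z00; rewrite /s0 sgE x00.
by rewrite /dot mulmx0 mxE oppr0 scale0r subr0.
Qed.

End KernelTrivial.

(** * Decay of matrix powers on an invariant hyperplane *)

Section PowerConvergence.
Variable R : realType.

Lemma cvg0_of_contraction (u e : nat -> R) (rho : R) :
  0 <= rho < 1 -> (forall k, 0 <= u k) ->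
  (forall k, u k.+1 <= rho * u k + e k) ->
  e k @[k --> \oo] --> 0 -> u k @[k --> \oo] --> 0.
Proof.
move=> /andP[rho0 rho1] u0 u_rec e0; apply/cvgr0Pnorm_le => eta eta0.
(* With this bound on [e], the value [eta / 2] reproduces itself: [rho * (eta / 2) + eta / 2 * (1 -
   rho) = eta / 2]. *)
have eta2 : 0 < eta / 2 * (1 - rho) by rewrite mulr_gt0 ?divr_gt0 // subr_gt0.
have /cvgr0Pnorm_le/(_ _ eta2)[N _ hN] := e0.
have bound j : u (N + j)%N <= rho ^+ j * u N + eta / 2.
  elim: j => [|j IHj]; first by rewrite addn0 expr0 mul1r lerDl divr_ge0 // ltW.
  have := hN (N + j)%N (leq_addr _ _); rewrite /= => /(le_trans (ler_norm _)) eN.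
  rewrite addnS exprS -mulrA; apply: le_trans (u_rec _) _.
  have : rho * u (N + j)%N <= rho * (rho ^+ j * u N + eta / 2) by rewrite ler_wpM2l.
  lra.
have geo : (fun j => rho ^+ j * u N) @ \oo --> 0.
  rewrite -(mul0r (u N)); apply: cvgM; last exact: cvg_cst.
  by apply: cvg_expr; rewrite ger0_norm.
have eta20 : 0 < eta / 2 by rewrite divr_gt0.
have /cvgr0Pnorm_le/(_ _ eta20)[J _ hJ] := geo.
exists (N + J)%N => // k /= NJk.
have Nk : (N <= k)%N by apply: leq_trans NJk; rewrite leq_addr.
rewrite ger0_norm // -(subnKC Nk); apply: le_trans (bound _) _.
have := hJ (k - N)%N; rewrite /= leq_subRL // => /(_ NJk)/(le_trans (ler_norm _)).
lra.
Qed.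

(** Induction on the factors of a product of [M - l] that kills [z]. If [1 <= |l|], injectivity on
    the hyperplane drops the factor. Otherwise [y = (M - l) z] decays by induction, and
    [M^(k+1) z = l M^k z + M^k y] is a contraction with a vanishing error. *)
Lemma powers_cvg0 m (M : 'M[R[i]]_m.+1) (u : 'rV[R[i]]_m.+1) (z : 'cV[R[i]]_m.+1) :
  u *m M = u ->
  (forall (y : 'cV_m.+1) l, u *m y = 0 -> 1 <= normc l -> M *m y = l *: y -> y = 0) ->
  u *m z = 0 -> norm_one (n := m) (M ^+ k *m z) @[k --> \oo] --> 0.
Proof.
move=> uM inj uz; have hN := norm_oneP R m; have [ND NZ _] := hN.
have [s sE] := closed_field_poly_normal (char_poly M).
have : (\prod_(l <- s) (M - l%:M)) *m z = 0.
  have := Cayley_Hamilton M; rewrite sE (monicP (char_poly_monic M)) scale1r rmorph_prod.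
  under eq_bigr do rewrite rmorphB /= horner_mx_X horner_mx_C.
  by move=> ->; rewrite mul0mx.
elim: s {sE} z uz => [|l s IHs] z uz.
  rewrite big_nil -[X in X *m _]/(1%:M) mul1mx => ->.
  under eq_fun do rewrite mulmx0 (vnorm0 hN).
  exact: cvg_cst.
rewrite big_cons -[X in X *m _]/(_ *m _) => hz.
have [l1|l1] := leP 1 (normc l).
  apply: IHs => //; apply: (inj _ l) => //.
    have stable (s' : seq R[i]) y : u *m y = 0 -> u *m (\prod_(l <- s') (M - l%:M) *m y) = 0.
      elim: s' y => [|l' s' IH'] y uy; first by rewrite big_nil -[X in _ *m (X *m _)]/(1%:M) mul1mx.
      rewrite big_cons -[X in _ *m (X *m _)]/(_ *m _) -mulmxA mulmxBl mulmxBr mulmxA uM.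
      by rewrite mul_scalar_mx -scalemxAr IH' // scaler0 subr0.
    exact: stable.
  apply/eqP; rewrite -subr_eq0 -mul_scalar_mx -mulmxBl mulmxA; exact/eqP.
pose y := M *m z - l *: z.
have uy : u *m y = 0 by rewrite mulmxBr mulmxA uM -scalemxAr uz scaler0 subr0.
have MQ : (M - l%:M) *m \prod_(k <- s) (M - k%:M) = \prod_(k <- s) (M - k%:M) *m (M - l%:M).
  have comm_sc c (A : 'M[R[i]]_m.+1) : GRing.comm A c%:M by apply: scalar_mxC.
  apply: commr_prod => k _; apply: commrB => //.
  by apply: commr_sym; apply: commrB => //; apply: commr_sym.
have /(IHs y uy) y0 : \prod_(k <- s) (M - k%:M) *m y = 0.
  by rewrite /y -mul_scalar_mx -mulmxBl mulmxA -MQ.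
apply: (cvg0_of_contraction (rho := normc l)) y0 => [|k|k].
- by rewrite normc_ge0.
- exact: vnorm_ge0.
- have -> : M ^+ k.+1 *m z = l *: (M ^+ k *m z) + M ^+ k *m y :> 'cV_m.+1.
    by rewrite exprSr -mulmxA /y mulmxBr -scalemxAr addrC subrK.
  by apply: le_trans (ND _ _) _; rewrite NZ.
Qed.

End PowerConvergence.

(** * [I - L] and [S] as stochastic matrices of the digraph *)

Section Laplacian.
Variables (R : realType) (n : nat).
Implicit Types (a : 'M[R]_n.+1) (e : rel 'I_n.+1).

Lemma stochastic_Lap a :
  (forall i j, 0 <= a i j) -> (forall i, \sum_j a i j < 1) -> stochastic (1%:M - Lap a).
Proof.
move=> a0 a1; split=> i; last first.
  have delta (c : R) : \sum_j c *+ (i == j) = c.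
    rewrite (bigD1 i) //= eqxx big1 ?addr0 // => j /negPf.
    by rewrite eq_sym => ->.
  under eq_bigr do rewrite !mxE.
  by rewrite !sumrB !delta subrr subr0.
move=> j; rewrite !mxE; case: eqVneq => [->|_]; rewrite ?mulr1n ?mulr0n.
  by rewrite opprB addrCA addr_ge0 // subr_ge0 ltW.
by rewrite sub0r add0r opprK.
Qed.

Lemma irreducible_Lap a e :
  (forall i j, 0 <= a i j) -> (forall i, \sum_j a i j < 1) ->
  (forall i j, e i j -> 0 < a i j) -> (forall i j, connect e i j) ->
  irreducible (1%:M - Lap a).
Proof.
move=> a0 a1 ea econn i j; apply: connect_sub (econn i j) => k l /ea akl.
apply: connect1; rewrite !mxE; case: eqVneq => [kl|_]; rewrite ?mulr1n ?mulr0n.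
  by rewrite opprB addrCA ltr_pwDl // subr_ge0 ltW.
by rewrite sub0r add0r opprK.
Qed.

(** Through this identity the results on row stochastic matrices reach [S]. *)
Lemma Smat_tr (b : 'M[R]_n.+1) : Smat b = (1%:M - Lap b)^T.
Proof. by apply/matrixP => i j; rewrite !mxE eq_sym opprB addrA addrAC; case: eqVneq => [->|]. Qed.

Lemma char_poly_M0mat (a b : 'M[R]_n.+1) :
  char_poly (M0mat a b) = char_poly (1%:M - Lap a) * char_poly (Smat b).
Proof.
rewrite /char_poly -(det_lblock _ (- map_mx polyC (Lap a))); congr (\det _).
rewrite /char_poly_mx /M0mat map_block_mx scalar_mx_block opp_block_mx add_block_mx.
by rewrite map_mx0 oppr0 addr0 add0r.
Qed.

End Laplacian.

(** * Resolvent bounds for [P] and [S] on their invariant hyperplanes *)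

Section Resolvents.
Variables (R : realType) (n : nat).

(** By [two_sided_fixed], [q(P)] is [c 1 w], so the product over [s] kills [x] and [resolvent_bound]
    applies; [3^n - 1] is rounded up to [3^n]. *)
Lemma stochastic_resolvent (P : 'M[R]_n.+1) (w : 'rV_n.+1) q s (r : R) (l : R[i]) x :
  stochastic P -> irreducible P -> w *m P = w -> (forall i, 0 < w 0 i) ->
  P *m horner_mx P q = horner_mx P q /\ horner_mx P q *m P = horner_mx P q ->
  \prod_(k <- s) (map_complex P - k%:M) = map_complex (horner_mx P q) ->
  size s = n -> {in s, forall k, normc k <= r} -> r < 1 -> 1 <= normc l ->
  dot (map_complex w) x = 0 ->
  norm_inf x <= 3 ^+ n / (1 - r) * norm_inf (l *: x - map_complex P *m x).
Proof.
move=> hP Pirr wP w0 [PH HP] prodE size_s hs r1 l1 wx.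
have [c cE] := two_sided_fixed hP Pirr wP w0 PH HP.
have Hx : (\prod_(k <- s) (map_complex P - k%:M)) *m x = 0.
  rewrite prodE; apply/matrixP => i j; rewrite ord1 !mxE.
  transitivity (c%:C%C * dot (map_complex w) x); last by rewrite wx mulr0.
  rewrite /dot mxE mulr_sumr; apply: eq_bigr => k _.
  by rewrite !mxE cE rmorphM mulrA.
have := resolvent_bound (norm_infP R n) (fun y => norm_inf_stochastic y hP) r1 l1 hs Hx.
rewrite size_s => h; apply: le_trans h _; rewrite ler_wpM2r ?norm_inf_ge0 //.
by rewrite ler_pM2r ?invr_gt0 ?subr_gt0 // gerBl.
Qed.

Lemma costochastic_resolvent (Q : 'M[R]_n.+1) (v : 'rV_n.+1) q s (r : R) (l : R[i]) x :
  stochastic Q -> irreducible Q -> v *m Q = v -> (forall i, 0 < v 0 i) ->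
  Q^T *m horner_mx Q^T q = horner_mx Q^T q /\ horner_mx Q^T q *m Q^T = horner_mx Q^T q ->
  \prod_(k <- s) (map_complex Q^T - k%:M) = map_complex (horner_mx Q^T q) ->
  size s = n -> {in s, forall k, normc k <= r} -> r < 1 -> 1 <= normc l ->
  dot (const_mx 1) x = 0 ->
  norm_one x <= 3 ^+ n / (1 - r) * norm_one (l *: x - map_complex Q^T *m x).
Proof.
move=> hQ Qirr vQ v0 [SH HS] prodE size_s hs r1 l1 ox.
(* After transposition [two_sided_fixed] applies to [Q] and [v]: [q(Q^T)] is a multiple of the
   column [v^T] times the row of ones, so it kills columns of sum zero. *)
have QH : Q *m (horner_mx Q^T q)^T = (horner_mx Q^T q)^T.
  by rewrite -[in RHS]HS trmx_mul trmxK.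
have HQ : (horner_mx Q^T q)^T *m Q = (horner_mx Q^T q)^T.
  by rewrite -[in RHS]SH trmx_mul trmxK.
have [c cE] := two_sided_fixed hQ Qirr vQ v0 QH HQ.
have Hx : (\prod_(k <- s) (map_complex Q^T - k%:M)) *m x = 0.
  rewrite prodE; apply/matrixP => i j; rewrite ord1 !mxE.
  transitivity ((c * v 0 i)%:C%C * dot (const_mx 1) x); last by rewrite ox mulr0.
  rewrite dot_const1 mulr_sumr; apply: eq_bigr => k _.
  by rewrite -(cE k i) !mxE.
have := resolvent_bound (norm_oneP R n) (fun y => norm_one_stochastic y hQ) r1 l1 hs Hx.
rewrite size_s => h; apply: le_trans h _; rewrite ler_wpM2r ?(vnorm_ge0 _ (norm_oneP R n)) //.
by rewrite ler_pM2r ?invr_gt0 ?subr_gt0 // gerBl.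
Qed.

End Resolvents.

(** As [n.+1 >= 2], the base [20 + 8 n.+1] is at least 36, and [(1 - r)^n.+1 <= (1 - r)^2] absorbs
    the square of [1 / (1 - r)]. With [36^n.+1 = 36 * 9^n * 4^n] and [n.+1 <= 4^n], at most
    [30 / 36] remains. *)
Lemma eps_small (R : realType) (n : nat) (r eps : R) : (0 < n)%N -> 0 <= r -> r < 1 ->
  eps < (1 - r) ^+ n.+1 / (20 + 8 * n.+1%:R) ^+ n.+1 ->
  30 * n.+1%:R * (3 ^+ n / (1 - r)) ^+ 2 * eps <= 1.
Proof.
move=> n0 r0 r1 heps; set G := 1 - r in heps *.
have G0 : 0 < G by rewrite subr_gt0.
have n1 : 1 <= n%:R :> R by rewrite ler1n.
have G2 : G ^+ n.+1 <= G ^+ 2.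
  by apply: ler_wiXn2l => //; [exact: ltW | rewrite /G gerBl].
have p36 : 36 ^+ n.+1 <= (20 + 8 * n.+1%:R) ^+ n.+1 :> R.
  rewrite ler_pXn2r ?nnegrE ?addr_ge0 ?mulr_ge0 //.
  by rewrite -natr1; lra.
have pos36 : 0 < 36 ^+ n.+1 :> R by rewrite exprn_gt0.
have e36 : eps <= G ^+ 2 / 36 ^+ n.+1.
  have pos : 0 < (20 + 8 * n.+1%:R) ^+ n.+1 :> R by apply: lt_le_trans p36.
  have i36 : ((20 + 8 * n.+1%:R) ^+ n.+1)^-1 <= (36 ^+ n.+1)^-1 :> R by rewrite lef_pV2.
  apply: le_trans (ltW heps) (ler_pM _ _ G2 i36); first by rewrite exprn_ge0 ?ltW.
  by rewrite invr_ge0 ltW.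
have n4 : n.+1%:R <= 4 ^+ n :> R by rewrite -natrX ler_nat; apply: ltn_expl.
have c9 : 0 < (3 ^+ n) ^+ 2 :> R by rewrite !exprn_gt0.
have c4 : 0 < 4 ^+ n :> R by rewrite exprn_gt0.
apply: (@le_trans _ _ (30 * n.+1%:R * (3 ^+ n / G) ^+ 2 * (G ^+ 2 / 36 ^+ n.+1))).
  apply: ler_wpM2l => //; apply: mulr_ge0; [exact: mulr_ge0 | exact: sqr_ge0].
have -> : 36 ^+ n.+1 = 36 * ((3 ^+ n) ^+ 2 * 4 ^+ n) :> R.
  rewrite exprS; congr (_ * _); rewrite -exprM mulnC exprM -exprMn; congr (_ ^+ _); ring.
have -> : 30 * n.+1%:R * (3 ^+ n / G) ^+ 2 * (G ^+ 2 / (36 * ((3 ^+ n) ^+ 2 * 4 ^+ n)))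
    = 30 * n.+1%:R / (36 * 4 ^+ n).
  field; rewrite !gt_eqF //.
rewrite ler_pdivrMr ?mulr_gt0 //; lra.
Qed.

(** * From the eigenvector condition to average consensus *)

Section Consensus.
Variables (R : realType) (n : nat) (a b : 'M[R]_n.+1) (eps : R).

Lemma ones_Mmat : stochastic (1%:M - Lap b) ->
  const_mx 1 *m Mmat a b eps = const_mx 1 :> 'rV_(n.+1 + n.+1).
Proof.
move=> hQ; rewrite -[in LHS]row_mx_const -[RHS]row_mx_const /Mmat mul_row_block.
congr (row_mx _ _).
  by rewrite mulmxBr mulmx1 subrK.
rewrite mulmxBr addrC subrK Smat_tr.
by have /(congr1 trmx) := stochastic_const hQ; rewrite trmx_mul trmx_const.
Qed.

Lemma Mmat_consensus_fixed (c : R) : stochastic (1%:M - Lap a) ->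
  Mmat a b eps *m col_mx (const_mx c) 0 = col_mx (const_mx c) 0 :> 'cV_(n.+1 + n.+1).
Proof.
move=> hP; have Lc : Lap a *m const_mx c = 0 :> 'cV_n.+1.
  have -> : const_mx c = c *: const_mx 1 :> 'cV_n.+1.
    by apply/matrixP => i j; rewrite !mxE mulr1.
  have /eqP := stochastic_const hP; rewrite mulmxBl mul1mx subr_eq addrC -subr_eq.
  by rewrite subrr -scalemxAr => /eqP <-; rewrite scaler0.
by rewrite /Mmat mul_block_col !mulmx0 !addr0 Lc mulmxBl mul1mx Lc subr0.
Qed.

(** The second relation is the sum of the two block rows, in which [L x] and [eps s] cancel. *)
Lemma Mmat_eigenvectorE (l : R[i]) (x s : 'cV[R[i]]_n.+1) :
  map_complex (Mmat a b eps) *m col_mx x s = l *: col_mx x s ->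
  map_complex (1%:M - Lap a) *m x + eps%:C%C *: s = l *: x /\
  x + map_complex (Smat b) *m s = l *: (x + s).
Proof.
rewrite /Mmat map_block_mx mul_block_col scale_col_mx => /eq_col_mx[e1 e2].
have sE : map_complex eps%:M *m s = eps%:C%C *: s by rewrite map_scalar_mx mul_scalar_mx.
rewrite sE in e1; split=> //.
rewrite scalerDr -e1 -e2 !map_mxB map_mx1 !mulmxBl mul1mx sE.
move: (map_complex (Lap a) *m x) (map_complex (Smat b) *m s) => A B.
by apply/matrixP => i j; rewrite !mxE; ring.
Qed.

End Consensus.

Lemma state_expr (R : realType) n (M : 'M[R]_(n.+1 + n.+1)) z k :
  state M z k = M ^+ k *m z :> 'cV_(n.+1 + n.+1).
Proof.
elim: k => [|k IHk]; first by rewrite -[X in X *m _]/(1%:M) mul1mx.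
by rewrite /state iterS -/(state M z k) IHk exprS mulmxA.
Qed.

Lemma consensus_of_injective (R : realType) n (a b : 'M[R]_n.+1) (eps : R) :
  stochastic (1%:M - Lap a) -> stochastic (1%:M - Lap b) ->
  (forall x s l, dot (const_mx 1) (x + s) = 0 -> 1 <= normc l ->
     map_complex (1%:M - Lap a) *m x + eps%:C%C *: s = l *: x ->
     x + map_complex (Smat b) *m s = l *: (x + s) -> x = 0 /\ s = 0) ->
  average_consensus (Mmat a b eps).
Proof.
move=> hP hQ inj x0 xa i; set M := Mmat a b eps.
pose zs : 'cV[R]_(n.+1 + n.+1) := col_mx (const_mx xa) 0.
(* [zs] is fixed by [M] and has the same mass as the initial state, so it suffices that [M^k d]
   tends to 0 for this [d] of mass zero. *)
pose d := col_mx x0 0 - zs.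
pose u : 'rV[R[i]]_(n.+1 + n.+1) := const_mx 1.
have uM : u *m map_complex M = u.
  have /(congr1 map_complex) := ones_Mmat a eps hQ.
  by rewrite map_mxM map_const_mx rmorph1.
have ud : u *m map_complex d = 0.
  have -> : u = map_complex (const_mx 1) by rewrite map_const_mx rmorph1.
  rewrite -map_mxM; have -> : const_mx 1 *m d = 0 :> 'rV_1; last by rewrite map_mx0.
  apply/matrixP => p q; rewrite !ord1 /d mulmxBr -[const_mx 1]row_mx_const !mul_row_col.
  rewrite !mulmx0 !addr0 !mxE; under eq_bigr do rewrite mxE mul1r.
  under [X in _ - X]eq_bigr do rewrite !mxE mul1r.
  rewrite sumr_const card_ord -[xa *+ _]mulr_natr /xa divfK ?subrr //.
(* [n.+1 + n.+1] is convertible to [(n + n.+1).+1], the successor form that [powers_cvg0]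
   expects. *)
have injM (y : 'cV[R[i]]_(n + n.+1).+1) l : u *m y = 0 -> 1 <= normc l ->
    map_complex M *m y = l *: y -> y = 0.
  rewrite -[y](@vsubmxK _ n.+1 n.+1 1).
  move: (usubmx _) (dsubmx _) => x s uy l1 /Mmat_eigenvectorE[e1 e2].
  have [|-> ->] := inj x s l _ l1 e1 e2; last by rewrite col_mx0.
  move: uy; rewrite /u -[const_mx 1]row_mx_const mul_row_col -mulmxDr /dot => ->.
  by rewrite mxE.
have cvg0 := @powers_cvg0 R (n + n.+1) (map_complex M) u (map_complex d) uM injM ud.
have stateE k : state M (col_mx x0 0) k i 0 = zs i 0 + (M ^+ k *m d : 'cV_(n.+1 + n.+1)) i 0.
  rewrite state_expr -[col_mx x0 0](subrK zs) -/d mulmxDr mxE addrC; congr (_ + _).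
  have -> // : M ^+ k *m zs = zs :> 'cV_(n.+1 + n.+1).
  elim: k => [|k IHk]; first by rewrite -[X in X *m _]/(1%:M) mul1mx.
  by rewrite exprSr -mulmxA Mmat_consensus_fixed.
have pow_cvg0 : (fun k => (M ^+ k *m d : 'cV_(n.+1 + n.+1)) i 0) @ \oo --> 0.
  apply/norm_cvg0P; apply: (squeeze_cvgr _ (cvg_cst 0) cvg0).
  apply: nearW => k; rewrite normr_ge0 /=.
  have := @normc_le_norm_one R (n + n.+1) (map_complex M ^+ k *m map_complex d) i.
  suff -> : map_complex M ^+ k *m map_complex d
      = map_complex (M ^+ k *m d : 'cV_(n.+1 + n.+1)) :> 'cV_(n.+1 + n.+1).
    by rewrite mxE normc_real.
  rewrite map_mxM; congr (_ *m _).
  elim: (k) => [|h IHh]; first by rewrite !expr0; apply/esym/map_mx1.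
  by rewrite !exprS IHh; apply/esym/map_mxM.
under eq_fun do rewrite stateE.
by have := cvgD (cvg_cst (zs i 0)) pow_cvg0; rewrite addr0; apply.
Qed.

Theorem proposition1 (R : realType) (n : nat) (e : rel 'I_n)
  (a b : 'M[R]_n) (r : R) :
  (1 < n)%N ->
  no_selfloops e ->
  strongly_connected e ->
  weights_a e a ->
  weights_b e b ->
  max_root_modulus (reduced_char_poly (M0mat a b)) r ->
  forall eps : R,
    0 < eps < (1 - r) ^+ n / (20 + 8 * n%:R) ^+ n ->
    average_consensus (Mmat a b eps).
Proof.
case: n e a b => [//|n] e a b n1 _ econn [ha ha1] [hb hb1] [[z0 z0_root z0_norm] max_r].
move=> eps /andP[eps0 eps_lt].
have a0 i j : 0 <= a i j.
  by case: (boolP (e j i)) => [/(ha i j).1/andP[/ltW]|/(ha i j).2->].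
have b0 i j : 0 <= b i j.
  by case: (boolP (e i j)) => [/(hb i j).1/andP[/ltW]|/(hb i j).2->].
have hP := stochastic_Lap a0 ha1; have hQ := stochastic_Lap b0 hb1.
have Pirr : irreducible (1%:M - Lap a).
  (* [a i j] weighs the edge [(j, i)], so [P] follows the reversed digraph. *)
  apply: (irreducible_Lap (e := fun i j => e j i)) => // i j.
    by move=> /(ha i j).1/andP[].
  by rewrite connect_rev; apply: econn.
have Qirr : irreducible (1%:M - Lap b).
  by apply: (irreducible_Lap (e := e)) => // i j /(hb i j).1/andP[].
have [w [wP w0 w1]] := stationary_exists hP Pirr.
have [v [vQ v0 v1]] := stationary_exists hQ Qirr.
have root1 (A : 'M[R]_n.+1) (u : 'rV_n.+1) :
    u *m A = u -> (forall i, 0 < u 0 i) -> root (char_poly A) 1.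
  move=> uA u0; rewrite -eigenvalue_root_char; apply/eigenvalueP; exists u.
    by rewrite uA scale1r.
  by apply: contraTneq (u0 0) => ->; rewrite mxE ltxx.
have [p [s [pE size_s sE Hp prod_s]]] := splitting_char_poly (root1 _ _ wP w0).
have rootQ : root (char_poly (1%:M - Lap b)^T) 1.
  by rewrite char_poly_tr; apply: root1 vQ v0.
have [q [t [qE size_t tE Hq prod_t]]] := splitting_char_poly rootQ.
(* Each diagonal block contributes one factor [X - 1], so the division is exact. *)
have redE : reduced_char_poly (M0mat a b) = p * q.
  rewrite /reduced_char_poly char_poly_M0mat Smat_tr pE qE mulrACA -expr2 mulpK //.
  by rewrite expf_neq0 // -polyC1 polyXsubC_eq0.
have rootE z : root (map_poly (fun x : R => x%:C%C) (reduced_char_poly (M0mat a b))) z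
    = (z \in s) || (z \in t).
  rewrite redE -[map_poly _ _]/(map_poly (real_complex R) _) rmorphM rootM.
  by rewrite sE tE.
have norm_le_r z : (z \in s) || (z \in t) -> normc z <= r.
  by rewrite -rootE => /max_r; rewrite -[`|z|]/(normc z)%:C%C lecR.
have r_norm : r = normc z0.
  by apply: complexI; rewrite -z0_norm.
have r0 : 0 <= r by rewrite r_norm normc_ge0.
have r_le1 : r <= 1.
  rewrite r_norm; move: z0_root; rewrite rootE => /orP[|].
    rewrite -sE => rz; apply: (stochastic_eigenvalue_le1 hP).
    by rewrite pE rmorphM rootM rz.
  rewrite -tE => rz; apply: (stochastic_eigenvalue_le1 hQ).
  by rewrite -char_poly_tr qE rmorphM rootM rz.
(* For [r = 1] the interval allowed for [eps] is empty. *)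
have r1 : r < 1.
  rewrite lt_neqAle r_le1 andbT; apply: contraTneq eps_lt => ->.
  by rewrite subrr expr0n mul0r -leNgt ltW.
have n0 : (0 < n)%N by [].
have small := eps_small n0 r0 r1 eps_lt.
have G0 : 0 < 1 - r by rewrite subr_gt0.
(* This uses [1 - r <= 1] and [n >= 1], the dimension being [n.+1]. *)
have K3 : 3 <= 3 ^+ n / (1 - r).
  rewrite ler_pdivlMr //; apply: (@le_trans _ _ 3); first lra.
  by rewrite -{1}(expr1 3) ler_eXn2l //; lra.
apply: consensus_of_injective => // x y l xy0 l1 eq1 eq2.
rewrite Smat_tr in eq2.
apply: (perturbed_kernel_trivial hP hQ wP w0 w1 vQ v0 v1 K3 eps0 small l1 _ _ eq1 eq2 xy0).
- move=> x' wx'; apply: (stochastic_resolvent hP Pirr wP w0 Hp prod_s size_s _ r1 l1 wx').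
  by move=> k ks; apply: norm_le_r; rewrite ks.
- move=> x' ox'; apply: (costochastic_resolvent hQ Qirr vQ v0 Hq prod_t size_t _ r1 l1 ox').
  by move=> k kt; apply: norm_le_r; rewrite kt orbT.
Qed.
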